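(* Let $f>0$ and let the reflection wall be the parabola $\mathcal B_P:\ x=-\frac{y^2}{4f}+f$ with focus at the Kepler center $F=(0,0)$. The parameters $(a,s_0)$, with $a>0$ and $s_0\in\mathbb R$, for which physical reflections of the Kepler ellipses with the boundary $\mathcal B_P$ occur are exactly those satisfying $$s_0<2a\quad\text{if } f\le s_0,\qquad\qquad 2f-2a<s_0\quad\text{if } s_0<f.$$
   Context: A particle moves under an attractive Kepler force with center $F=(0,0)$ and is reflected elastically at $\mathcal B_P$. A Kepler ellipse with semi-major axis $a$ and second focus $F_i$ is $\{X:|FX|+|XF_i|=2a\}$ with $|FF_i|<2a$ (non-degenerate). In this billiard the second foci of all Kepler ellipses of one orbit lie on a common vertical line $x=s_0$, called the foci-line. Physical reflections occur for $(a,s_0)$ if there is a point $F_i=(s_0,F_y)$ on the foci-line such that the non-degenerate Kepler ellipse with foci $F,F_i$ and semi-major axis $a$ intersects $\mathcal B_P$ at some point non-tangentially (tangential contact is not counted as a physical reflection). *)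

(* Defs.v *)
From Stdlib Require Import Reals.
From Coquelicot Require Import Coquelicot.
Open Scope R_scope.

(** Plane curves are given as zero sets [g x y = 0] of functions
    [g : R -> R -> R]. *)

(** [L] is the tangent line at [(x0, y0)] of the curve [g = 0], where [g] is
    (totally) differentiable at [(x0, y0)] with gradient [(gx, gy) <> 0]. *)
Definition is_tangent_line (g : R -> R -> R) (x0 y0 : R)
    (L : R -> R -> Prop) : Prop :=
  exists gx gy : R,
    differentiable_pt_lim g x0 y0 gx gy /\
    (gx <> 0 \/ gy <> 0) /\
    forall x y : R, L x y <-> gx * (x - x0) + gy * (y - y0) = 0.

(** Both tangent lines are required to exist, so a singular point of either
    curve never counts as a non-tangential intersection. *)
Definition intersect_nontangentially_at (g h : R -> R -> R) (x0 y0 : R)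
    : Prop :=
  g x0 y0 = 0 /\ h x0 y0 = 0 /\
  exists L M : R -> R -> Prop,
    is_tangent_line g x0 y0 L /\ is_tangent_line h x0 y0 M /\
    ~ (forall x y : R, L x y <-> M x y).

Definition parabolic_wall (f : R) : R -> R -> R :=
  fun x y => x - (- (y ^ 2 / (4 * f)) + f).

(** The Kepler center, which is the first focus, is the origin; [(p, q)] is
    the second focus. [dist_euc x0 y0 x1 y1] is the Euclidean distance from
    [(x0, y0)] to [(x1, y1)]. *)
Definition kepler_ellipse (a p q : R) : R -> R -> R :=
  fun x y => dist_euc 0 0 x y + dist_euc x y p q - 2 * a.

Definition nondegenerate_ellipse (a p q : R) : Prop :=
  dist_euc 0 0 p q < 2 * a.

Definition physical_reflections_occur (f a s0 : R) : Prop :=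
  exists Fy : R,
    nondegenerate_ellipse a s0 Fy /\
    exists x y : R,
      intersect_nontangentially_at
        (kepler_ellipse a s0 Fy) (parabolic_wall f) x y.

(* Main.v *)
(** Every point [X = (x, y)] of the wall satisfies [|FX| = 2f - x], the
    distance to the directrix, so it lies on the ellipse iff
    [|XF_i| = 2a - 2f + x].  If [s0 <= 2f - 2a], this gives
    [|XF_i| <= x - s0], so [F_i] lies on the horizontal through [X]; there the
    ellipse is tangent to the wall by the reflection property of the parabola.
    Non-degeneracy gives [s0 < 2a].  Conversely, if [2f - 2a < s0 < 2a], the
    wall point with abscissa [x = f - (2a - s0)/4] and [y > 0] satisfies
    [|x - s0| < 2a - 2f + x], and the second focus on the foci-line at that
    distance from it and strictly below it gives a transversal intersection. *)
Require Import Defs.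
From Stdlib Require Import Reals Lra.
From Coquelicot Require Import Coquelicot.
Open Scope R_scope.

(** * Gradients of functions of two variables *)

Lemma differentiable_pt_lim_linear (h : R -> R -> R) (a b x y : R) :
  (forall u v, h u v = a * u + b * v) -> differentiable_pt_lim h x y a b.
Proof.
intros Hh eps; exists (mkposreal 1 Rlt_0_1); intros u v _ _.
replace (h u v - h x y - _) with 0 by (rewrite !Hh; ring).
rewrite Rabs_R0; apply Rmult_le_pos; [apply Rlt_le, cond_pos|].
eapply Rle_trans; [apply Rabs_pos|apply Rmax_l].
Qed.

Lemma differentiable_pt_lim_comp1 (phi : R -> R) (h : R -> R -> R)
    (x y l hx hy : R) :
  is_derive phi (h x y) l -> differentiable_pt_lim h x y hx hy ->
  differentiable_pt_lim (fun u v => phi (h u v)) x y (l * hx) (l * hy).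
Proof.
intros Hphi Hh; apply is_derive_Reals in Hphi.
replace (l * hx) with (l * hx + 0 * hx) by ring.
replace (l * hy) with (l * hy + 0 * hy) by ring.
apply (differentiable_pt_lim_comp (fun u _ => phi u) h h); trivial.
now apply differentiable_pt_lim_proj1_0.
Qed.

Lemma differentiable_pt_lim_plus (g h : R -> R -> R) (x y gx gy hx hy : R) :
  differentiable_pt_lim g x y gx gy -> differentiable_pt_lim h x y hx hy ->
  differentiable_pt_lim (fun u v => g u v + h u v) x y (gx + hx) (gy + hy).
Proof.
intros Hg Hh.
replace (gx + hx) with (1 * gx + 1 * hx) by ring.
replace (gy + hy) with (1 * gy + 1 * hy) by ring.
apply (differentiable_pt_lim_comp Rplus); trivial.
apply differentiable_pt_lim_linear; intros; ring.
Qed.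

Lemma differentiable_pt_lim_separable (phi psi : R -> R) (x y a b : R) :
  is_derive phi x a -> is_derive psi y b ->
  differentiable_pt_lim (fun u v => phi u + psi v) x y a b.
Proof.
intros Hphi Hpsi.
replace a with (a * 1 + b * 0) by ring.
replace b with (a * 0 + b * 1) at 2 by ring.
apply differentiable_pt_lim_plus.
- apply (differentiable_pt_lim_comp1 phi (fun u _ => u)); trivial.
  apply differentiable_pt_lim_linear; intros; ring.
- apply (differentiable_pt_lim_comp1 psi (fun _ v => v)); trivial.
  apply differentiable_pt_lim_linear; intros; ring.
Qed.

Lemma differentiable_pt_lim_gradient_unique (g : R -> R -> R)
    (x y gx gy gx' gy' : R) :
  differentiable_pt_lim g x y gx gy -> differentiable_pt_lim g x y gx' gy' ->
  gx = gx' /\ gy = gy'.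
Proof.
intros H H'.
apply differentiable_pt_lim_unique in H.
apply differentiable_pt_lim_unique in H'.
destruct H, H'; split; congruence.
Qed.

(** * Distances, the wall and the ellipse *)

Lemma dist_euc_pos (x y p q : R) : 0 <= dist_euc x y p q.
Proof. apply sqrt_pos. Qed.

Lemma dist_euc_sqr (x y p q : R) :
  dist_euc x y p q ^ 2 = (x - p) ^ 2 + (y - q) ^ 2.
Proof.
unfold dist_euc; rewrite pow2_sqrt; [unfold Rsqr; ring|].
apply Rplus_le_le_0_compat; apply Rle_0_sqr.
Qed.

Lemma dist_euc_unique (x y p q d : R) :
  0 <= d -> d ^ 2 = (x - p) ^ 2 + (y - q) ^ 2 -> dist_euc x y p q = d.
Proof.
intros Hd H; unfold dist_euc.
replace ((x - p)² + (y - q)²) with (d ^ 2) by (rewrite H; unfold Rsqr; ring).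
now apply sqrt_pow2.
Qed.

(** Chain rule for the square root: away from [(p, q)] the radicand is positive, and the gradient is
    a unit vector. *)
Lemma differentiable_dist_euc (x y p q : R) :
  0 < dist_euc x y p q ->
  differentiable_pt_lim (fun u v => dist_euc u v p q) x y
    ((x - p) / dist_euc x y p q) ((y - q) / dist_euc x y p q).
Proof.
intros Hd.
assert (H0 : 0 < (x - p)² + (y - q)²).
{ pose proof (dist_euc_sqr x y p q); unfold Rsqr; nra. }
replace ((x - p) / _) with (/ (2 * dist_euc x y p q) * (2 * (x - p)))
  by (field; lra).
replace ((y - q) / _) with (/ (2 * dist_euc x y p q) * (2 * (y - q)))
  by (field; lra).
apply (differentiable_pt_lim_comp1 sqrt (fun u v => (u - p)² + (v - q)²)).
- apply is_derive_Reals, derivable_pt_lim_sqrt; exact H0.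
- apply (differentiable_pt_lim_separable
           (fun u => (u - p)²) (fun v => (v - q)²));
    unfold Rsqr; auto_derive; trivial; ring.
Qed.

Lemma differentiable_parabolic_wall (f x y : R) :
  f <> 0 -> differentiable_pt_lim (parabolic_wall f) x y 1 (y / (2 * f)).
Proof.
intros Hf.
apply (differentiable_pt_lim_separable
         (fun u => u) (fun v => - (- (v ^ 2 / (4 * f)) + f)));
  auto_derive; trivial; field; trivial.
Qed.

Lemma differentiable_kepler_ellipse (a p q x y : R) :
  0 < dist_euc 0 0 x y -> 0 < dist_euc x y p q ->
  differentiable_pt_lim (kepler_ellipse a p q) x y
    (x / dist_euc 0 0 x y + (x - p) / dist_euc x y p q)
    (y / dist_euc 0 0 x y + (y - q) / dist_euc x y p q).
Proof.
intros Hr Hd.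
rewrite (distance_symm 0 0 x y) in *.
apply (differentiable_pt_lim_ext
  (fun u v => dist_euc u v 0 0 + (dist_euc u v p q + - (2 * a)))).
{ exists (mkposreal 1 Rlt_0_1); intros u v _ _; unfold kepler_ellipse.
  rewrite (distance_symm 0 0 u v); ring. }
apply differentiable_pt_lim_plus.
- replace (x / _) with ((x - 0) / dist_euc x y 0 0) by (f_equal; ring).
  replace (y / _) with ((y - 0) / dist_euc x y 0 0) by (f_equal; ring).
  now apply differentiable_dist_euc.
- replace ((x - p) / _) with (1 * ((x - p) / dist_euc x y p q)) by ring.
  replace ((y - q) / _) with (1 * ((y - q) / dist_euc x y p q)) by ring.
  apply (differentiable_pt_lim_comp1 (fun t => t + - (2 * a))).
  + auto_derive; trivial.
  + now apply differentiable_dist_euc.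
Qed.

Lemma parabolic_wall_eq0 (f x y : R) :
  f <> 0 -> parabolic_wall f x y = 0 <-> y ^ 2 = 4 * f * (f - x).
Proof.
intros Hf; unfold parabolic_wall; split; intros H.
- replace x with (- (y ^ 2 / (4 * f)) + f) by lra; field; trivial.
- rewrite H; field; trivial.
Qed.

Lemma parabolic_wall_dist_focus (f x y : R) :
  0 < f -> parabolic_wall f x y = 0 -> x <= f /\ dist_euc 0 0 x y = 2 * f - x.
Proof.
intros Hf H; apply parabolic_wall_eq0 in H; [|lra].
assert (Hx : x <= f) by nra.
split; trivial.
(* On the wall [x^2 + y^2 = x^2 + 4 f (f - x) = (2 f - x)^2]. *)
apply dist_euc_unique; [lra|]; nra.
Qed.

(** Gradients are unique, so they determine both tangent lines. Lines through a common point
    coincide iff their normals are parallel, and the normal of the wall is [(1, y / (2 f))]. *)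
Lemma intersect_nontangentially_wall (g : R -> R -> R) (f x y gx gy : R) :
  f <> 0 -> differentiable_pt_lim g x y gx gy ->
  intersect_nontangentially_at g (parabolic_wall f) x y <->
  g x y = 0 /\ parabolic_wall f x y = 0 /\
  (gx <> 0 \/ gy <> 0) /\ gy <> y / (2 * f) * gx.
Proof.
intros Hf Hg.
pose proof (differentiable_parabolic_wall f x y Hf) as Hw.
split.
- intros (H1 & H2 & L & M & (lx & ly & Hl & Hl0 & HL)
            & (mx & my & Hm & Hm0 & HM) & Hne).
  destruct (differentiable_pt_lim_gradient_unique _ _ _ _ _ _ _ Hg Hl).
  destruct (differentiable_pt_lim_gradient_unique _ _ _ _ _ _ _ Hw Hm).
  subst lx ly mx my.
  repeat split; trivial.
  intros Heq; apply Hne; intros u v; rewrite HL, HM.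
  assert (Hgx : gx <> 0) by (intros ->; destruct Hl0; lra).
  replace (gx * (u - x) + gy * (v - y))
    with (gx * (1 * (u - x) + y / (2 * f) * (v - y))) by (rewrite Heq; ring).
  split.
  + intros H; apply Rmult_integral in H; destruct H; [contradiction|trivial].
  + intros ->; ring.
- intros (H1 & H2 & H0 & Hne).
  split; [trivial|split; [trivial|]].
  exists (fun u v => gx * (u - x) + gy * (v - y) = 0),
    (fun u v => 1 * (u - x) + y / (2 * f) * (v - y) = 0).
  split; [|split].
  + exists gx, gy; repeat split; trivial.
  + exists 1, (y / (2 * f)); repeat split; trivial; left; lra.
  + intros H.
    (* A second point of the wall's tangent line; if it lies on the other line too, the normals are
       parallel. *)
    specialize (H (x - y / (2 * f)) (y + 1)).
    apply Hne.
    assert (gx * (x - y / (2 * f) - x) + gy * (y + 1 - y) = 0)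
      by (apply H; ring).
    lra.
Qed.

(** * Necessity of the two bounds *)

Lemma physical_reflections_bound_above (f a s0 : R) :
  physical_reflections_occur f a s0 -> s0 < 2 * a.
Proof.
intros (q & Hnd & _); unfold nondegenerate_ellipse in Hnd.
pose proof (dist_euc_pos 0 0 s0 q).
pose proof (dist_euc_sqr 0 0 s0 q).
nra.
Qed.

Lemma physical_reflections_bound_below (f a s0 : R) :
  0 < f -> physical_reflections_occur f a s0 -> 2 * f - 2 * a < s0.
Proof.
intros Hf (q & Hnd & x & y & Hint).
apply Rnot_le_lt; intros Hs.
assert (He : kepler_ellipse a s0 q x y = 0) by apply Hint.
assert (Hw : parabolic_wall f x y = 0) by apply Hint.
destruct (parabolic_wall_dist_focus f x y Hf Hw) as [Hx Hr].
unfold nondegenerate_ellipse in Hnd.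
unfold kepler_ellipse in He.
pose proof (dist_euc_pos x y s0 q) as Hd0.
pose proof (dist_euc_sqr x y s0 q) as Hd2.
assert (Hq : q = y) by nra.
subst q.
assert (Hd : dist_euc x y s0 y = x - s0) by nra.
(* If [x = s0], then [F_i = X] and [|FF_i| = 2a], against non-degeneracy. *)
assert (Hpos : 0 < x - s0).
{ destruct (Req_dec x s0) as [<-|Hne]; lra. }
assert (Hg := differentiable_kepler_ellipse a s0 y x y).
rewrite Hr, Hd in Hg.
specialize (Hg ltac:(lra) ltac:(lra)).
apply (intersect_nontangentially_wall _ f x y _ _ ltac:(lra) Hg) in Hint.
(* With [r = 2 f - x] the gradient of the ellipse is [(x / r + 1, y / r)], which is [2 f / r] times
   that of the wall. *)
apply Hint; field; lra.
Qed.

(** * Sufficiency of the two bounds *)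

Lemma physical_reflections_of_bounds (f a s0 : R) :
  0 < f -> 2 * f - 2 * a < s0 -> s0 < 2 * a ->
  physical_reflections_occur f a s0.
Proof.
intros Hf Hlo Hup.
(* [s0 - x < d] means [x > f - (2 a - s0) / 2], and [y > 0] needs [x < f]; this is the midpoint. *)
set (x := f - (2 * a - s0) / 4).
set (d := 2 * a - 2 * f + x).
set (r := 2 * f - x).
set (y := sqrt (4 * f * (f - x))).
set (e := sqrt (d ^ 2 - (x - s0) ^ 2)).
assert (Hr : 0 < r) by (unfold r, x; lra).
assert (Hd1 : x - s0 < d) by (unfold d; lra).
assert (Hd2 : s0 - x < d) by (unfold d, x; lra).
assert (Hy : 0 < y).
{ apply sqrt_lt_R0; apply Rmult_lt_0_compat; [lra|]; unfold x; lra. }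
assert (He : 0 < e) by (apply sqrt_lt_R0; nra).
assert (Hy2 : y ^ 2 = 4 * f * (f - x)).
{ unfold y; apply pow2_sqrt, Rmult_le_pos; [lra|]; unfold x; lra. }
assert (He2 : e ^ 2 = d ^ 2 - (x - s0) ^ 2).
{ unfold e; apply pow2_sqrt; nra. }
assert (Hw : parabolic_wall f x y = 0) by (apply parabolic_wall_eq0; lra).
assert (HFX : dist_euc 0 0 x y = r).
{ now apply parabolic_wall_dist_focus. }
assert (HXF : dist_euc x y s0 (y - e) = d).
{ apply dist_euc_unique; [lra|]; nra. }
assert (Hr2 : r ^ 2 = x ^ 2 + y ^ 2) by (unfold r; rewrite Hy2; ring).
exists (y - e); split.
- (* [X] is not on the segment from [F] to [F_i], as [F_i] is lower than
     [X] and [y > 0]: the triangle inequality is strict. *)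
  assert (Hxr : - r <= x <= r) by (unfold r in *; split; nra).
  assert (Hcs : x * (s0 - x) < r * d).
  (* The two products add up to [2 (r d - x (s0 - x))]. *)
  { assert (0 < (r - x) * (d + (s0 - x)))
      by (apply Rmult_lt_0_compat; unfold r, x in *; lra).
    assert (0 <= (r + x) * (d - (s0 - x)))
      by (apply Rmult_le_pos; lra).
    lra. }
  pose proof (dist_euc_pos 0 0 s0 (y - e)).
  pose proof (dist_euc_sqr 0 0 s0 (y - e)).
  assert (H2a : 2 * a = r + d) by (unfold r, d; ring).
  unfold nondegenerate_ellipse; rewrite H2a.
  (* [|FF_i|^2 = r^2 + d^2 + 2 (x (s0 - x) - y e)], where [y e > 0]. *)
  assert (dist_euc 0 0 s0 (y - e) ^ 2 < (r + d) ^ 2) by nra.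
  nra.
- exists x, y.
  assert (Hg := differentiable_kepler_ellipse a s0 (y - e) x y).
  rewrite HFX, HXF in Hg.
  specialize (Hg ltac:(lra) ltac:(lra)).
  apply (intersect_nontangentially_wall _ f x y _ _ ltac:(lra) Hg).
  (* Since [r = 2 f - x], the terms in [r] add up to [y / (2 f)]. *)
  assert (Hne : 0 < y / r + (y - (y - e)) / d
                    - y / (2 * f) * (x / r + (x - s0) / d)).
  { replace (y / r + _ - _)
      with ((y * (d - (x - s0)) + 2 * f * e) / (2 * f * d))
      by (unfold r in *; field; lra).
    apply Rdiv_lt_0_compat; [|apply Rmult_lt_0_compat; lra].
    apply Rplus_lt_0_compat; apply Rmult_lt_0_compat; lra. }
  split; [|split; [trivial|split; [|lra]]].
  + unfold kepler_ellipse; rewrite HFX, HXF; unfold r, d; ring.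
  + destruct (Req_dec (x / r + (x - s0) / d) 0) as [E|E]; [right|now left].
    rewrite E in Hne; lra.
Qed.

Theorem proposition7p2 (f a s0 : R) (hf : 0 < f) (ha : 0 < a) :
  physical_reflections_occur f a s0 <->
  ((f <= s0 -> s0 < 2 * a) /\ (s0 < f -> 2 * f - 2 * a < s0)).
Proof.
split.
- intros H; split; intros _.
  + exact (physical_reflections_bound_above f a s0 H).
  + exact (physical_reflections_bound_below f a s0 hf H).
- intros [H1 H2].
  (* In each case one bound implies the other: [f <= s0 < 2 a] gives [2 f - 2 a < 2 f - s0 <= s0],
     and [2 f - 2 a < s0 < f] gives [2 a > 2 f - s0 > s0]. *)
  apply physical_reflections_of_bounds; trivial;
    destruct (Rlt_le_dec s0 f) as [H|H];
    [specialize (H2 H)|specialize (H1 H)|specialize (H2 H)|specialize (H1 H)];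
    lra.
Qed.
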